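(* Let $k\ge 1$ be an integer. Then $-1$ is an eigenvalue of multiplicity $1$ of the adjacency matrix of the Andrásfai graph $\mathrm{And}(k)$ if and only if $k$ is odd.
   Context: For an integer $k\ge 1$ put $n=3k-1$. The Andrásfai graph $\mathrm{And}(k)$ is the Cayley graph $\mathrm{Cay}(\mathbb{Z}_n,S)$ of the additive group $\mathbb{Z}_n=\{0,1,\dots,n-1\}$ with connection set $S=\{x\in\mathbb{Z}_n : x\equiv 1 \bmod 3\}=\{1,4,7,\dots,3k-2\}$, where the congruence mod $3$ is for the representatives $0,1,\dots,n-1$. That is, the vertices are the elements of $\mathbb{Z}_n$, and $u,v$ are adjacent iff $v-u\in S$ (the set $S$ satisfies $S=-S$ and $0\notin S$). *)

(* Defs.v *)
From mathcomp Require Import all_boot all_order all_algebra.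

Set Implicit Arguments.
Unset Strict Implicit.
Unset Printing Implicit Defensive.

Import GRing.Theory.
Local Open Scope ring_scope.

Definition cayley_rel (G : finZmodType) (S : {set G}) : rel G :=
  fun u v => v - u \in S.

(* For 1 <= k we have 2 <= 3 * k - 1, so that 'Z_(3 * k - 1) really is the
   group of integers modulo 3 * k - 1, on representatives 0, ..., 3 * k - 2. *)
Definition andrasfai_set (k : nat) : {set 'Z_(3 * k - 1)} :=
  [set x : 'Z_(3 * k - 1) | (x == 1 %[mod 3])%N].

Definition andrasfai (k : nat) : rel 'Z_(3 * k - 1) :=
  cayley_rel (andrasfai_set k).

Arguments andrasfai k : clear implicits.

Definition adjacency_mx (R : nzRingType) (m : nat) (e : rel 'I_m) : 'M[R]_m :=
  \matrix_(u, v) (e u v)%:R.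

(* The multiplicity is the algebraic one. For the adjacency matrix of a graph
   over the real or complex numbers, which is real symmetric, it equals the
   dimension of the eigenspace. *)
Definition eigenvalue_of_mult (F : fieldType) (m : nat) (A : 'M[F]_m) (a : F)
    (d : nat) : Prop :=
  eigenvalue A a /\ mup a (char_poly A) = d.

(* Main.v *)
Require Import Defs.

From mathcomp Require Import all_boot all_order all_algebra.
From mathcomp Require Import algC cyclotomic.
From mathcomp Require Import zify ring.

Set Implicit Arguments.
Unset Strict Implicit.
Unset Printing Implicit Defensive.

Import GRing.Theory.
Local Open Scope ring_scope.

(** Write [n = 3 k - 1]. A Cayley graph on Z/n is a circulant, so the characters
    of Z/n diagonalize its adjacency matrix: over a field with a primitive n-th
    root of unity [z], the characteristic polynomial is the product over
    [j < n] of [X - lambda (z ^ j)], where [lambda w] is the sum of [w ^ s]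
    over the connection set ([char_poly_cayley]).

    For the Andrasfai graph, [lambda w] is the geometric sum
    [w + w ^ 4 + ... + w ^ (3 k - 2)], and [w ^ n = 1] turns the telescoped form
    [(w ^ 3 - 1) * lambda w = w ^ (3 k + 1) - w] into
    [(w ^ 3 - 1) * lambda w = w ^ 2 - w]. Hence [lambda w = -1] forces
    [(w - 1) * (w + 1) ^ 2 = 0]. As [lambda 1 = k], the only solution is
    [w = -1], and it is one ([andrasfai_lambda_eqN1]). So the multiplicity of
    -1 is the number of [j < n] with [z ^ j = -1], which is 1 if [n] is even,
    that is if [k] is odd, and 0 otherwise ([card_prim_root_eqN1]).

    The ground field need not contain roots of unity. The characteristic
    polynomial has rational coefficients, and root multiplicities do not change
    under field extension ([mup_map_poly]), so the computation takes place over
    the algebraic numbers. *)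

Lemma mup_map_poly (F F' : fieldType) (f : {rmorphism F -> F'}) (a : F)
    (p : {poly F}) :
  p != 0 -> mup (f a) (map_poly f p) = mup a p.
Proof.
move=> p0; have fp0 : map_poly f p != 0 by rewrite map_poly_eq0.
(* Divisibility by powers of X - a, which characterizes the multiplicity, is
   reflected by field morphisms because polynomial division commutes with
   them. *)
have mapX n : ('X - (f a)%:P) ^+ n = map_poly f (('X - a%:P) ^+ n).
  by rewrite rmorphXn /= map_polyXsubC.
apply/eqP; rewrite eqn_leq mup_leq // mapX dvdp_map -mup_leq // leqnn.
by rewrite mup_geq // mapX dvdp_map -mup_geq // leqnn.
Qed.

Lemma mup_prod_XsubC (F : fieldType) (I : finType) (f : I -> F) (a : F) :
  mup a (\prod_i ('X - (f i)%:P)) = #|[pred i | f i == a]|.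
Proof.
rewrite -sum1_card [RHS]big_mkcond /=.
suff [] : mup a (\prod_i ('X - (f i)%:P)) = (\sum_i (f i == a))%N
    /\ \prod_i ('X - (f i)%:P) != 0.
  by move=> -> _; apply: eq_bigr => i _; rewrite inE; case: eqP.
apply: (big_rec2 (fun p m => mup a p = m /\ p != 0)).
  by split; [apply: mupNroot; rewrite root1 | apply: oner_neq0].
move=> i m p _ [<- p0]; have X0 := polyXsubC_eq0 (f i).
rewrite mulf_neq0 ?X0 // mupM ?X0 //; split=> //.
by rewrite -['X - _]expr1 mup_XsubCX; case: eqP.
Qed.

(** The multiplicity of an integer eigenvalue of a graph does not depend on the
    field of characteristic zero: both sides are compared with the rational
    characteristic polynomial. *)
Lemma mup_char_poly_adjacency (R R' : numFieldType) (m : nat) (e : rel 'I_m)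
    (c : int) :
  mup c%:~R (char_poly (adjacency_mx R e))
    = mup c%:~R (char_poly (adjacency_mx R' e)).
Proof.
suff toQ (K : numFieldType) : mup c%:~R (char_poly (adjacency_mx K e))
    = mup c%:~R (char_poly (adjacency_mx rat e)) by rewrite !toQ.
have -> : adjacency_mx K e = map_mx (@ratr K) (adjacency_mx rat e).
  by apply/matrixP => u v; rewrite !mxE rmorph_nat.
rewrite -map_char_poly -(mup_map_poly (@ratr K)) ?rmorph_int //.
by rewrite monic_neq0 ?char_poly_monic.
Qed.

Lemma char_poly_eigenbasis (F : fieldType) (n : nat) (A V : 'M[F]_n)
    (d : 'rV[F]_n) :
  V \in unitmx -> A *m V = V *m diag_mx d ->
  char_poly A = \prod_i ('X - (d 0 i)%:P).
Proof.
move=> Vu AV; pose W := map_mx polyC V.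
have detW : \det W != 0.
  by rewrite det_map_mx polyC_eq0 -unitfE -unitmxE.
have -> : \prod_i ('X - (d 0 i)%:P) = char_poly (diag_mx d).
  rewrite char_poly_trig ?diag_mx_is_trig //.
  by apply: eq_bigr => i _; rewrite mxE eqxx.
have : char_poly_mx A *m W = W *m char_poly_mx (diag_mx d).
  by rewrite mulmxBl mulmxBr scalar_mxC -!map_mxM AV.
move/(congr1 determinant); rewrite !det_mulmx mulrC.
exact: (mulfI detW).
Qed.

Lemma Vandermonde_prim_root_unit (F : fieldType) (n : nat) (z : F) :
  n.-primitive_root z ->
  Vandermonde n (\row_(j < n) z ^+ j) \in unitmx.
Proof.
move=> zP; rewrite unitmxE unitfE det_Vandermonde.
apply/prodf_neq0 => i _; apply/prodf_neq0 => j ltij.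
rewrite !mxE subr_eq0 (eq_prim_root_expr zP) !modn_small //.
by rewrite neq_ltn ltij orbT.
Qed.

(** The eigenvectors are the characters [u |-> (z ^ j) ^ u] of Z/n: translating
    the summation variable by [u] takes the factor [(z ^ j) ^ u] out. *)
Lemma char_poly_cayley (F : fieldType) (m : nat) (z : F)
    (S : {set 'I_m.+2}) :
  m.+2.-primitive_root z ->
  char_poly (adjacency_mx F (cayley_rel S))
    = \prod_(j < m.+2) ('X - (\sum_(s in S) (z ^+ j) ^+ s)%:P).
Proof.
move=> zP; pose d : 'rV[F]_m.+2 := \row_j \sum_(s in S) (z ^+ j) ^+ s.
rewrite (@char_poly_eigenbasis _ _ _ _ d (Vandermonde_prim_root_unit zP)).
  by apply: eq_bigr => j _; rewrite mxE.
apply/matrixP => u j; rewrite mul_mx_diag !mxE.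
have w1 : (z ^+ j) ^+ m.+2 = 1 by rewrite exprAC (prim_expr_order zP) expr1n.
rewrite (reindex_inj (addrI u)) mulr_sumr [RHS]big_mkcond /=.
apply: eq_bigr => s _; rewrite !mxE /cayley_rel (addrC u) addrK.
case: (s \in S); last by rewrite mul0r.
by rewrite mul1r -exprD (expr_mod _ w1) addnC.
Qed.

(** The powers of [z] below [n] are distinct and exhaust the n-th roots of unity,
    so the count is 1 exactly when -1 is one of these roots. *)
Lemma card_prim_root_eqN1 (R : numFieldType) (n : nat) (z : R) :
  n.-primitive_root z -> #|[pred j : 'I_n | z ^+ j == -1]| = ~~ odd n.
Proof.
move=> zP; have [n_odd | n_even] /= := boolP (odd n).
  apply: eq_card0 => j; rewrite inE; apply/negP => /eqP zj.
  have : (z ^+ j) ^+ n = 1 by rewrite exprAC (prim_expr_order zP) expr1n.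
  rewrite zj -signr_odd n_odd expr1 => /eqP.
  by rewrite eq_sym -addr_eq0 -mulr2n Num.Theory.pnatr_eq0.
have N1n : (-1 : R) ^+ n = 1 by rewrite -signr_odd (negPf n_even).
have [i Di] := prim_rootP zP N1n.
rewrite -[RHS](card1 i); apply: eq_card => j; rewrite !inE Di.
by rewrite (eq_prim_root_expr zP) !modn_small.
Qed.

(** The index 3 k - 1 is congruent to 2 mod 3, so the range [x < 3 k] has the
    same terms as [x < 3 k - 1], and it splits into blocks of three. *)
Lemma andrasfai_sum (F : fieldType) (k : nat) (w : F) : (1 <= k)%N ->
  \sum_(s in andrasfai_set k) w ^+ s = \sum_(i < k) w ^+ (3 * i).+1.
Proof.
move=> hk.
transitivity (\sum_(0 <= x < 3 * k - 1 | (x %% 3 == 1)%N) w ^+ x).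
  have Dn : ((Zp_trunc (3 * k - 1)).+2 = 3 * k - 1)%N by rewrite Zp_cast; lia.
  rewrite -[in RHS]Dn big_mkord; apply: eq_bigl => x.
  by rewrite inE.
transitivity (\sum_(0 <= x < 3 * k | (x %% 3 == 1)%N) w ^+ x).
  have -> : (3 * k = (3 * k - 1).+1)%N by lia.
  rewrite subn1 /= [RHS]big_mkcond big_nat_recr //= -big_mkcond /=.
  by rewrite ifF ?addr0 //; lia.
elim: k {hk} => [|k IHk]; first by rewrite big_geq // big_ord0.
rewrite big_ord_recr /= -IHk mulnS addnC addn3.
rewrite big_mkcond !big_nat_recr //= -big_mkcond /=.
have -> : ((3 * k) %% 3 == 1)%N = false by lia.
have -> : ((3 * k).+1 %% 3 == 1)%N by lia.
have -> : ((3 * k).+2 %% 3 == 1)%N = false by lia.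
by rewrite !addr0.
Qed.

Lemma geometric_sum_step3 (F : fieldType) (k : nat) (w : F) :
  (w ^+ 3 - 1) * (\sum_(i < k) w ^+ (3 * i).+1) = w ^+ (3 * k).+1 - w.
Proof.
elim: k => [|k IHk]; first by rewrite big_ord0 mulr0 subrr.
rewrite big_ord_recr mulrDr IHk /= mulnS !exprS exprD; ring.
Qed.

Lemma andrasfai_lambda_eqN1 (R : numFieldType) (k : nat) (w : R) :
  (1 <= k)%N -> w ^+ (3 * k - 1) = 1 ->
  (\sum_(s in andrasfai_set k) w ^+ s == -1) = (w == -1).
Proof.
move=> hk wn; rewrite andrasfai_sum //.
have tel := geometric_sum_step3 k w.
have Dn : ((3 * k).+1 = 3 * k - 1 + 2)%N by lia.
rewrite Dn exprD wn mul1r in tel.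
apply/eqP/eqP => [lamN1 | wN1]; last first.
  (* At w = -1 the telescoped identity reads -2 * lambda = 2. *)
  rewrite wN1 in tel *; have two0 : (2 : R) != 0 by rewrite Num.Theory.pnatr_eq0.
  apply: (mulfI two0); set L := \sum_(i < k) _ in tel *.
  have -> : 2 * L = - (((-1) ^+ 3 - 1) * L) by ring.
  by rewrite tel; ring.
have : (w - 1) * (w + 1) ^+ 2 = 0.
  have -> : (w - 1) * (w + 1) ^+ 2 = w ^+ 2 - w - (w ^+ 3 - 1) * -1 by ring.
  by rewrite -tel lamN1 subrr.
move/eqP; rewrite mulf_eq0 expf_eq0 /= subr_eq0 addr_eq0.
case/orP=> /eqP // w1; move/eqP: lamN1.
rewrite w1 (eq_bigr (fun=> 1)) => [|i _]; last by rewrite expr1n.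
by rewrite sumr_const card_ord -addr_eq0 -mulrSr Num.Theory.pnatr_eq0.
Qed.

Lemma mup_andrasfai (R : numFieldType) (k : nat) : (1 <= k)%N ->
  mup (-1) (char_poly (adjacency_mx R (andrasfai k))) = odd k.
Proof.
move=> hk; have := mup_char_poly_adjacency R algC (andrasfai k) (-1).
rewrite !rmorphN1 => ->.
have Dn : ((Zp_trunc (3 * k - 1)).+2 = 3 * k - 1)%N by rewrite Zp_cast; lia.
have [z zP] := @C_prim_root_exists (Zp_trunc (3 * k - 1)).+2 isT.
rewrite (char_poly_cayley _ zP) mup_prod_XsubC.
have -> : odd k = ~~ odd (Zp_trunc (3 * k - 1)).+2 by rewrite Dn; lia.
rewrite -(card_prim_root_eqN1 zP); apply: eq_card => j; rewrite !inE.
apply: andrasfai_lambda_eqN1 => //.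
by have zn := prim_expr_order zP; rewrite Dn in zn; rewrite exprAC zn expr1n.
Qed.

Theorem lemma3p4 (R : numFieldType) (k : nat) (hk : (1 <= k)%N) :
  eigenvalue_of_mult (adjacency_mx R (andrasfai k)) (-1) 1 <-> odd k.
Proof.
rewrite /eigenvalue_of_mult mup_andrasfai //; split=> [[_] | k_odd].
  by case: (odd k).
split; last by rewrite k_odd.
rewrite eigenvalue_root_char; apply: contraT => /mupNroot.
by rewrite mup_andrasfai // k_odd.
Qed.
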